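(* Let $r\in\mathbb R_{>2}$. Then the closed circle graph $E_r^{\mathrm c}$ and the open circle graph $E_r^{\mathrm o}$ are not equivalent.
   Context: Graphs are simple and may be infinite. A cohomomorphism $G\to H$ is a map $f:V(G)\to V(H)$ such that for all distinct non-adjacent $u,v\in V(G)$ the vertices $f(u),f(v)$ are distinct and non-adjacent in $H$. Write $G\le H$ if there is a cohomomorphism $G\to H$. Graphs $G,H$ are equivalent if $G\le H$ and $H\le G$. Let $C$ be a circle of unit circumference, with distance measured along the circle. For $r\in\mathbb R_{\ge2}$, $E_r^{\mathrm o}$ (resp. $E_r^{\mathrm c}$) is the graph with vertex set $C$ in which two distinct vertices are adjacent iff their distance on $C$ is strictly less than $1/r$ (resp. at most $1/r$). *)

(* Defs.v *)
From mathcomp Require Import all_boot all_order all_algebra.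
From mathcomp Require Import reals.
Set Implicit Arguments.
Unset Strict Implicit.
Unset Printing Implicit Defensive.
Import Order.TTheory GRing.Theory Num.Theory.
Local Open Scope ring_scope.

Record graph := Graph {
  vertex :> Type;
  adj : vertex -> vertex -> Prop;
  adj_sym : forall u v, adj u v -> adj v u;
  adj_irrefl : forall u, ~ adj u u
}.

Definition cohomomorphism (G H : graph) (f : G -> H) : Prop :=
  forall u v : G, u <> v -> ~ adj u v -> f u <> f v /\ ~ adj (f u) (f v).

Definition cohom_le (G H : graph) : Prop :=
  exists f : G -> H, cohomomorphism f.

Definition graph_equiv (G H : graph) : Prop := cohom_le G H /\ cohom_le H G.

(* The circle of unit circumference, each point being given by its arc-length
   coordinate in [0, 1[ from a fixed base point. *)
Definition circle (R : realType) := {x : R | 0 <= x < 1}.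

(* The two arcs joining the points with coordinates x and y have lengths
   `|x - y| and 1 - `|x - y|; the distance is that of the shorter one. *)
Definition circle_dist (R : realType) (x y : circle R) : R :=
  Num.min `|val x - val y| (1 - `|val x - val y|).

Lemma circle_distC (R : realType) (x y : circle R) :
  circle_dist x y = circle_dist y x.
Proof. by rewrite /circle_dist distrC. Qed.

Definition open_adj (R : realType) (r : R) (x y : circle R) : Prop :=
  x <> y /\ circle_dist x y < r^-1.

Definition closed_adj (R : realType) (r : R) (x y : circle R) : Prop :=
  x <> y /\ circle_dist x y <= r^-1.

Lemma open_adj_sym (R : realType) (r : R) (x y : circle R) :
  open_adj r x y -> open_adj r y x.
Proof. by case=> xy d; split; [move=> yx; apply: xy | rewrite circle_distC]. Qed.

Lemma open_adj_irrefl (R : realType) (r : R) (x : circle R) :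
  ~ open_adj r x x.
Proof. by case. Qed.

Lemma closed_adj_sym (R : realType) (r : R) (x y : circle R) :
  closed_adj r x y -> closed_adj r y x.
Proof. by case=> xy d; split; [move=> yx; apply: xy | rewrite circle_distC]. Qed.

Lemma closed_adj_irrefl (R : realType) (r : R) (x : circle R) :
  ~ closed_adj r x x.
Proof. by case. Qed.

Definition open_circle_graph (R : realType) (r : R) : graph :=
  Graph (@open_adj_sym R r) (@open_adj_irrefl R r).

Definition closed_circle_graph (R : realType) (r : R) : graph :=
  Graph (@closed_adj_sym R r) (@closed_adj_irrefl R r).

(* Main.v *)
Require Import Defs.
From mathcomp Require Import all_boot all_order all_algebra.
From mathcomp Require Import boolp reals.
From mathcomp Require Import zify ring lra.
Set Implicit Arguments.
Unset Strict Implicit.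
Unset Printing Implicit Defensive.
Import Order.TTheory GRing.Theory Num.Theory.
Local Open Scope ring_scope.

(** The identity is a cohomomorphism from the closed graph to the open one, so
    the claim is that there is none in the other direction.  With a = 1 / r, such
    a map g sends points of the circle at distance at least a to points at
    distance more than a ([spreading]).  It is refuted by counting, along N
    equally spaced samples, how many images lie in an arc.

    The samples whose image lies in a closed arc of length a are pairwise at
    distance less than a, and there are at most q of these, where q is about
    a * N ([cyclic_independent_card], [closed_arc_count]).  Rotating the arc, the
    average of this number is a * N: the bound is almost sharp, and g has no
    room.

    If a is rational, the bound is exact for suitable N, and the strict
    inequality satisfied by g gives a contradiction ([spreading_irrational]).

    If a is irrational, chains of M consecutive arcs of length a wind around the
    circle and come arbitrarily close to any given arc length modulo 1
    ([dense_multiples]).  This turns the upper bound for arcs of length a into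
    a lower bound for all arcs: an arc of length l contains asymptotically at
    least l * N images ([arc_preimage_density]).  On the other hand, a point with
    its image within a of g u is itself within a of u.  Comparing measures for
    two points at a small distance h shows that their images are at distance at
    most h ([spreading_no_stretch]).  So g maps points at distance a, joined by
    small steps, to points at distance at most a, which contradicts the strict
    inequality ([not_spreading]). *)

(** * Independent sets in the cyclic group *)

(** The key finite bound: a set of residues mod N whose pairwise cyclic
    distances are below q has at most q elements.  Seen from its least element
    m, such a set lies in the q positions from m on together with the q - 1
    positions before m; two positions of these that differ by N - q are at
    cyclic distance at least q, so shifting the second block by N - q folds the
    set injectively into q positions. *)
Lemma cyclic_independent_card (N q : nat) (S : {set 'I_N}) :
  (2 * q <= N)%N ->
  (forall i j, i \in S -> j \in S -> (i <= j)%N ->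
     (j - i < q)%N || (N - q < j - i)%N) ->
  (#|S| <= q)%N.
Proof.
move=> leqN indep.
have [->|[i0 i0S]] := set_0Vmem S; first by rewrite cards0.
have [m mS m_min] := arg_minnP (fun i : 'I_N => i : nat) i0S.
have q_gt0 : (0 < q)%N.
  by have := indep _ _ mS mS (leqnn _); have := ltn_ord m; lia.
pose fold (i : 'I_N) :=
  (if (i - m < q)%N then i - m else i - m - (N - q))%N.
have foldq i : i \in S -> (fold i < q)%N.
  move=> iS; have := indep _ _ mS iS (m_min _ iS); rewrite /fold.
  by have := ltn_ord i; have := m_min _ iS; case: ifP; lia.
have fold_inj : {in S &, injective fold}.
  suff le_inj i j :
      i \in S -> j \in S -> (i <= j)%N -> fold i = fold j -> i = j.
    move=> i j iS jS eqf; case: (leqP i j) => [|/ltnW] ij; first exact: le_inj.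
    by apply/esym/le_inj.
  move=> iS jS ij; have := indep _ _ iS jS ij.
  have := indep _ _ mS iS (m_min _ iS); have := indep _ _ mS jS (m_min _ jS).
  have := m_min _ iS; have := m_min _ jS; have := ltn_ord i; have := ltn_ord j.
  by rewrite /fold; case: ifP => ?; case: ifP => ? *; apply: val_inj => /=; lia.
have foldE i : i \in S -> (inord (fold i) : 'I_q.-1.+1) = fold i :> nat.
  by move=> iS; rewrite inordK // prednK // foldq.
have : {in S &, injective (fun i => inord (fold i) : 'I_q.-1.+1)}.
  by move=> i j iS jS /(congr1 val) /=; rewrite !foldE //; apply: fold_inj.
by move/leq_card_in; rewrite card_ord prednK.
Qed.

(** * Integer parts and cardinalities *)

Lemma floor_bounds (R : archiRealFieldType) (x : R) :
  (Num.floor x)%:~R <= x < (Num.floor x)%:~R + 1.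
Proof. by have := floor_itv x; rewrite intrD. Qed.

Lemma ceil_bounds (R : archiRealFieldType) (x : R) :
  (Num.ceil x)%:~R - 1 < x <= (Num.ceil x)%:~R.
Proof. by have := ceil_itv x; rewrite intrB. Qed.

Lemma sum_le_card (N : nat) (S : {set 'I_N}) (t : 'I_N -> int) :
  (forall i, t i <= 1) -> (forall i, 0 < t i -> i \in S) ->
  \sum_i t i <= #|S|%:Z.
Proof.
move=> t_le1 t_gt0.
have -> : #|S|%:Z = \sum_i (i \in S)%:Z.
  rewrite -sum1_card (big_morph Posz PoszD (erefl _)) big_mkcond /=.
  by apply: eq_bigr => i _; case: (i \in S).
apply: ler_sum => i _; have := t_gt0 i; have := t_le1 i.
by case: (i \in S) => //= _; case: (ltrP 0 (t i)) => // _ /(_ isT).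
Qed.

(** * Maps that spread far points *)

(** Points of the circle are represented by real numbers modulo 1, so their
    distance is the least absolute value of x - y - k over the integers k. *)
Definition far (R : archiRealFieldType) (a x y : R) : Prop :=
  forall k : int, a <= `|x - y - k%:~R|.

Definition strictly_far (R : archiRealFieldType) (a x y : R) : Prop :=
  forall k : int, a < `|x - y - k%:~R|.

Definition spreading (R : archiRealFieldType) (a : R) (g : R -> R) : Prop :=
  forall x y, far a x y -> strictly_far a (g x) (g y).

(** The contrapositive of spreading, in the form in which it is applied: points
    with close images are close. *)
Lemma spreading_near (R : archiRealFieldType) (a : R) (g : R -> R) (x y : R)
    (k : int) : spreading a g -> `|g x - g y - k%:~R| <= a ->
  exists j : int, `|x - y - j%:~R| < a.
Proof.
move=> gP le_a; apply: contrapT => /forallNP nfar.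
have /gP/(_ k) : far a x y by move=> j; rewrite leNgt; apply/negP/nfar.
by rewrite ltNge le_a.
Qed.

(** * Samples in an arc *)

(** The number of integer translates of y that lie in a half-open interval
    ]s, t] is the difference of the integer parts of t - y and s - y.  Summing
    over a family of points makes the number of them in the arc ]s, t] of the
    circle, with multiplicity if the arc winds, a difference of values of one
    function; counts over consecutive arcs then telescope. *)
Definition lift_count (R : archiRealFieldType) (N : nat) (y : 'I_N -> R) (s : R)
    : int := \sum_(i < N) Num.floor (s - y i).

(** The left limit of lift_count at s: it turns the count over ]s, t] into the
    count over the closed arc [s, t]. *)
Definition lift_count_before (R : archiRealFieldType) (N : nat) (y : 'I_N -> R)
    (s : R) : int := \sum_(i < N) (Num.ceil (s - y i) - 1).

Definition samples (R : archiRealFieldType) (g : R -> R) (x0 : R) (N : nat)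
    (i : 'I_N) : R := g (x0 + i%:R / N%:R).

Lemma lift_count_shift (R : archiRealFieldType) (N : nat) (y : 'I_N -> R)
    (s : R) (L : int) : lift_count y (s + L%:~R) = lift_count y s + L * N%:Z.
Proof.
rewrite /lift_count.
under eq_bigr do rewrite addrAC floorDrz ?intr_int // intrKfloor.
by rewrite big_split /= sumr_const card_ord pmulrn mulrzz.
Qed.

Lemma lift_count_mono (R : archiRealFieldType) (N : nat) (y : 'I_N -> R)
    (s t : R) :
  s <= t -> lift_count y s <= lift_count y t.
Proof. by move=> st; apply: ler_sum => i _; apply: le_floor; rewrite lerB. Qed.

Lemma lift_count_before_le (R : archiRealFieldType) (N : nat) (y : 'I_N -> R)
  (s : R) : lift_count_before y s <= lift_count y s.
Proof.
apply: ler_sum => i _; rewrite real_floor_ge_int ?num_real // intrB.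
by have := ceil_bounds (s - y i); lra.
Qed.

(** Two images in a closed arc of length a are not strictly far from each other,
    so their sample points are at distance less than a: the samples with image
    in the arc are an independent set of the cyclic group of order N. *)
Lemma closed_arc_count (R : archiRealFieldType) (a : R) (g : R -> R) (x0 : R)
    (N q : nat) (s : R) :
  0 < a < 1 -> spreading a g -> a * N%:R <= q%:R -> (2 * q <= N)%N ->
  lift_count (samples g x0 (N := N)) (s + a) <=
    lift_count_before (samples g x0 (N := N)) s + q%:Z.
Proof.
move=> a01 gP aNq leqN.
set y := @samples _ _ _ _.
rewrite -lerBlDl /lift_count /lift_count_before -sumrB.
pose t i := Num.floor (s + a - y i) - (Num.ceil (s - y i) - 1).
apply: (@le_trans _ _ #|[set i | 0 < t i]|%:Z).
  apply: sum_le_card => i; last by rewrite inE.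
  have : Num.floor (s + a - y i) < Num.ceil (s - y i) + 1.
    rewrite -(ltr_int R) intrD; have := floor_bounds (s + a - y i).
    by have := ceil_bounds (s - y i); lra.
  by rewrite ltzD1; lra.
rewrite lez_nat; apply: cyclic_independent_card => // i j.
rewrite !inE => ti tj ij; rewrite -[_ || _]negbK; apply/negP.
rewrite negb_or -!leqNgt => /andP[q_le le_Nq].
have N_gt0 : 0 < N%:R :> R by rewrite ltr0n; have := ltn_ord i; lia.
(* The sample points i and j, of index distance between q and N - q, are
   q / N apart on the circle, which is at least a. *)
have : strictly_far a (y j) (y i).
  apply: gP => k.
  have -> : x0 + j%:R / N%:R - (x0 + i%:R / N%:R) - k%:~R
      = ((j%:R - i%:R) - N%:R * k%:~R) / N%:R :> R.
    by field; rewrite gt_eqF.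
  rewrite normf_div (gtr0_norm N_gt0) ler_pdivlMr //; apply: le_trans aNq _.
  rewrite -natrB // -[N%:R]/(N%:Z%:~R) -[(j - i)%:R]/((j - i)%:Z%:~R).
  rewrite -intrM -intrB -intr_norm -[q%:R]/(q%:Z%:~R) ler_int.
  by case: (lerP k 0) => k0; [nia | case: (lerP k 1) => k1; nia].
move=> /(_ (Num.floor (s + a - y i) - Num.floor (s + a - y j))).
rewrite ltNge => /negP; apply.
move: ti tj; rewrite /t.
have := floor_bounds (s + a - y i); have := ceil_bounds (s - y i).
have := floor_bounds (s + a - y j); have := ceil_bounds (s - y j).
move=> h1 h2 h3 h4; rewrite !subr_gt0 !ltrBlDr !ltzD1.
rewrite -2!(ler_int R) intrB ler_norml; lra.
Qed.

(** M consecutive arcs of length a.  Closing the first of them on the left costs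
    nothing, and this is where the strict inequality in the definition of
    spreading enters: it excludes rational a. *)
Lemma closed_arc_count_iter (R : archiRealFieldType) (a : R) (g : R -> R)
    (x0 : R) (N q M : nat) (s : R) :
  0 < a < 1 -> spreading a g -> a * N%:R <= q%:R -> (2 * q <= N)%N ->
  (0 < M)%N ->
  lift_count (samples g x0 (N := N)) (s + M%:R * a) <=
    lift_count_before (samples g x0 (N := N)) s + M%:Z * q%:Z.
Proof.
move=> a01 gP aNq leqN; case: M => // M _.
elim: M => [|M IH]; first by rewrite !mul1r; apply: closed_arc_count.
have -> : s + M.+2%:R * a = (s + M.+1%:R * a) + a.
  by rewrite -[M.+2]addn1 natrD; ring.
apply: (le_trans (@closed_arc_count _ _ _ _ _ q _ a01 gP aNq leqN)).
have := lift_count_before_le (samples g x0 (N := N)) (s + M.+1%:R * a); lia.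
Qed.

(** * The rational case *)

Lemma lift_count_jump (R : archiRealFieldType) (N : nat) (y : 'I_N -> R)
    (i0 : 'I_N) : lift_count_before y (y i0) < lift_count y (y i0).
Proof.
rewrite /lift_count_before /lift_count [X in X < _](bigD1 i0) //=.
rewrite [X in _ < X](bigD1 i0) //= subrr ceil0 floor0 ltr_leD //.
apply: ler_sum => i _; rewrite real_floor_ge_int ?num_real // intrB.
by have := ceil_bounds (y i0 - y i); lra.
Qed.

(** If M arcs of length a wind exactly L times around the circle, take N = M
    samples and q = L.  The M arcs already account for all L * M crossings of
    the samples, which leaves none for the left end point of the first arc; yet
    that point may be chosen to be the image of a sample. *)
Lemma spreading_irrational (R : archiRealFieldType) (a : R) (g : R -> R)
    (M : nat) (L : int) :
  0 < a < 2^-1 -> spreading a g -> (0 < M)%N -> L%:~R <> M%:R * a.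
Proof.
move=> a01 gP M_gt0 LMa.
have MR : 0 < M%:R :> R by rewrite ltr0n.
have L_gt0 : 0 < L by rewrite -(ltr_int R) LMa mulr_gt0 //; lra.
case: L L_gt0 LMa => // q _ LMa.
have leqM : (2 * q <= M)%N.
  have : M%:R * a <= M%:R * 2^-1 by rewrite ler_wpM2l; lra.
  by rewrite -(ler_nat R) natrM -[q%:R]/(q%:Z%:~R) LMa; lra.
have aMq : a * M%:R <= q%:R by rewrite -[q%:R]/(q%:Z%:~R) LMa; lra.
have a1 : 0 < a < 1 by lra.
pose y := @samples R g 0 M; pose i0 := Ordinal M_gt0.
have := closed_arc_count_iter 0 (y i0) a1 gP aMq leqM M_gt0.
rewrite -LMa lift_count_shift mulrC lerD2r leNgt.
by rewrite lift_count_jump.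
Qed.

(** * Density of the multiples of an irrational number *)

(** The pigeonhole principle for the fractional parts of 0, a, ..., K * a in K
    boxes. *)
Lemma dirichlet (R : archiRealFieldType) (a : R) (K : nat) :
  (0 < K)%N ->
  exists (M : nat) (L : int), (0 < M)%N /\ `|L%:~R - M%:R * a| < K%:R^-1.
Proof.
move=> K_gt0; have KR : 0 < K%:R :> R by rewrite ltr0n.
pose fr (i : nat) : R := i%:R * a - (Num.floor (i%:R * a))%:~R.
have fr_ge0 i : 0 <= fr i by have := floor_bounds (i%:R * a); rewrite /fr; lra.
have fr_lt1 i : fr i < 1 by have := floor_bounds (i%:R * a); rewrite /fr; lra.
pose box (i : nat) := Num.truncn (K%:R * fr i).
have boxP i : (box i)%:R <= K%:R * fr i < (box i)%:R + 1.
  by rewrite natr1; apply: truncn_itv; rewrite mulr_ge0 // ltW.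
have box_lt i : (box i < K)%N.
  rewrite -(ltr_nat R); have := boxP i; have := fr_lt1 i; nra.
have /injectivePn[i [j ij eq_box]] :
    ~~ injectiveb (fun i : 'I_K.+1 => Ordinal (box_lt i)).
  by apply/negP => /injectiveP /leq_card; rewrite !card_ord ltnn.
wlog lt_ij : i j ij eq_box / (i < j)%N => [hwlog|].
  case: (ltngtP i j) => [|lt_ji|/val_inj eij]; first exact: hwlog ij eq_box.
    by apply: (hwlog j i) => //; rewrite eq_sym.
  by rewrite eij eqxx in ij.
exists (j - i)%N, (Num.floor (j%:R * a) - Num.floor (i%:R * a)).
split; first by rewrite subn_gt0.
have {}eq_box : box i = box j := congr1 val eq_box.
have -> : (Num.floor (j%:R * a) - Num.floor (i%:R * a))%:~R - (j - i)%:R * a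
   = fr i - fr j.
  by rewrite /fr natrB ?(ltnW lt_ij) // intrB; ring.
have := boxP i; have := boxP j; rewrite eq_box => /andP[b1 b2] /andP[b3 b4].
rewrite -(ltr_pM2l KR) mulfV ?gt_eqF // -[X in X * _]gtr0_norm //.
by rewrite -normrM mulrBr ltr_norml; lra.
Qed.

(** Multiples of a small nonzero number L - M * a reach the interval from 0 if
    it is positive, and descend into it from 1 if it is negative; in both cases
    the coefficient of a stays of the required sign. *)
Lemma dense_multiples (R : archiRealFieldType) (a lo hi : R) :
  (forall (M : nat) (L : int), (0 < M)%N -> L%:~R <> M%:R * a) ->
  0 <= lo -> lo < hi -> hi <= 1 ->
  exists (M : nat) (L : int), lo < L%:~R - M%:R * a < hi.
Proof.
move=> irr lo0 lohi hi1.
have steps (b : R) (d : R) : 0 <= b -> 0 < d ->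
    exists n : nat, n.-1%:R * d <= b < n%:R * d /\ (0 < n)%N.
  move=> b0 d0; exists (Num.truncn (b / d)).+1; split=> //=.
  rewrite -ler_pdivlMr // -ltr_pdivrMr //; apply: truncn_itv.
  by rewrite divr_ge0 // ltW.
have [//|M [L [M_gt0]]] := @dirichlet R a (Num.truncn (hi - lo)^-1).+1.
set K := _.+1%:R.
have K_gt : (hi - lo)^-1 < K by apply: real_truncnS_gt; rewrite num_real.
have w0 : 0 < hi - lo by lra.
have K_inv : K^-1 < hi - lo.
  by rewrite -[ltRHS]invrK ltf_pV2 // posrE ?invr_gt0 // /K ltr0n.
move: (irr M L M_gt0) K_inv; set z := K^-1; clearbody z => LM K_inv dlt.
case: (ltrgtP (L%:~R - M%:R * a) 0) => [neg|pos|eq0]; last by lra.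
- have [||n [n1 n0]] := steps (1 - hi) (M%:R * a - L%:~R); [lra|lra|].
  exists (n * M)%N, (1 + n%:Z * L).
  rewrite intrD intrM natrM -[n%:~R]/(n%:R : R).
  case: n n0 n1 => // n _ /=; rewrite -natr1 => n1.
  rewrite ltr0_norm // in dlt.
  have -> : 1%:~R + (n%:R + 1) * L%:~R - (n%:R + 1) * M%:R * a
    = 1 - (n%:R + 1) * (M%:R * a - L%:~R) by ring.
  lra.
- have [|n [n1 n0]] := steps lo (L%:~R - M%:R * a) lo0; first lra.
  exists (n * M)%N, (n%:Z * L).
  rewrite intrM natrM -[n%:~R]/(n%:R : R).
  case: n n0 n1 => // n _ /=; rewrite -natr1 => n1.
  rewrite gtr0_norm // in dlt.
  have -> : (n%:R + 1) * L%:~R - (n%:R + 1) * M%:R * a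
    = (n%:R + 1) * (L%:~R - M%:R * a) by ring.
  lra.
Qed.

(** * Images of equidistributed samples are equidistributed *)

(** Choose th = L - M * a slightly below l.  From the end of an arc of length th,
    M arcs of length a lead back, after L turns, to the beginning of this arc.
    They contain at most M * q samples out of L * N, so the arc of length th
    receives at least L * N - M * q of them.  As q is within 1 of a * N, this is
    N * th up to a bounded error. *)
Lemma arc_preimage_density (R : archiRealFieldType) (a l e : R) (g : R -> R) :
  0 < a < 2^-1 -> spreading a g -> 0 < l <= 1 -> 0 < e ->
  exists N0 : nat, forall (N : nat) (x0 s : R), (N0 <= N)%N ->
    N%:R * (l - e) <=
      (lift_count (samples g x0 (N := N)) (s + l)
       - lift_count (samples g x0 (N := N)) s)%:~R.
Proof.
move=> a01 gP l01 e0.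
pose lo := Num.max 0 (l - e).
have [lo_ge0 lo_ge lo_lt] : [/\ 0 <= lo, l - e <= lo & lo < l].
  by rewrite /lo; split; case: (lerP 0 (l - e)); lra.
have [|M [L /andP[th1 th2]]] := dense_multiples
  (fun M L => @spreading_irrational R a g M L a01 gP) lo_ge0 lo_lt; first lra.
set th := L%:~R - M%:R * a in th1 th2.
(* The first bound makes 2 * q <= N for the q below, the second makes the
   error M negligible. *)
exists (maxn (Num.truncn (2 / (1 - 2 * a))).+1
             (Num.truncn (M%:R / (th - (l - e)))).+1).
move=> N x0 s; rewrite geq_max -!(ler_nat R) => /andP[N1 N2].
have {}N1 : 2 <= N%:R * (1 - 2 * a).
  rewrite -ler_pdivrMr; last lra.
  by apply: le_trans N1; apply/ltW/real_truncnS_gt/num_real.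
have {}N2 : M%:R <= N%:R * (th - (l - e)).
  rewrite -ler_pdivrMr; last lra.
  by apply: le_trans N2; apply/ltW/real_truncnS_gt/num_real.
have N_ge0 : 0 <= N%:R :> R by rewrite ler0n.
pose q := (Num.truncn (a * N%:R)).+1.
have q_gt : a * N%:R <= q%:R by apply/ltW/real_truncnS_gt/num_real.
have q_le : q%:R <= a * N%:R + 1.
  by rewrite /q -natr1 lerD2r truncn_le mulr_ge0 //; lra.
have leqN : (2 * q <= N)%N by rewrite -(ler_nat R) natrM; lra.
have a1 : 0 < a < 1 by lra.
set y := @samples _ _ _ _.
have iter :
    lift_count y (s + th + M%:R * a) <= lift_count y (s + th) + M%:Z * q%:Z.
  case: (posnP M) => [->|M_gt0]; first by rewrite !mul0r !addr0.
  apply: (le_trans (closed_arc_count_iter _ _ a1 gP q_gt leqN M_gt0)).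
  by rewrite lerD2r lift_count_before_le.
have mono : lift_count y (s + th) <= lift_count y (s + l).
  by apply: lift_count_mono; rewrite lerD2l ltW.
have eLs : s + th + M%:R * a = s + L%:~R by rewrite /th; ring.
rewrite eLs lift_count_shift in iter.
have : L * N%:Z - M%:Z * q%:Z <= lift_count y (s + l) - lift_count y s by lra.
rewrite -(ler_int R); apply: le_trans.
rewrite intrB !intrM -![_%:Z%:~R]/(_%:R : R).
have M_ge0 : 0 <= M%:R :> R by rewrite ler0n.
have : M%:R * q%:R <= M%:R * (a * N%:R + 1) by rewrite ler_wpM2l.
have -> : L%:~R = th + M%:R * a by rewrite /th; ring.
clearbody th; lra.
Qed.

(** * Spreading maps do not increase small distances *)

Lemma card_initial_segment (R : archiRealFieldType) (N : nat) (c : R) :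
  0 <= c -> #|[set i : 'I_N | i%:R < c]|%:R <= c + 1.
Proof.
move=> c0; apply: (@le_trans _ _ (Num.truncn c).+1%:R); last first.
  by rewrite -natr1 lerD2r truncn_le.
rewrite ler_nat; apply: (@leq_trans #|'I_(Num.truncn c).+1|); last first.
  by rewrite card_ord.
apply: (@leq_card_in _ _ (fun i : 'I_N => inord i)) => i j.
have lt_c (k : 'I_N) : k%:R < c -> (k < (Num.truncn c).+1)%N.
  move=> kc; rewrite -(ltr_nat R); apply: (lt_trans kc).
  by apply: real_truncnS_gt; rewrite num_real.
rewrite !inE => ic jc /(congr1 val) /=; rewrite !inordK ?lt_c //.
exact: val_inj.
Qed.

Lemma floor_lt_arc (R : archiRealFieldType) (s t y : R) :
  0 < Num.floor (t - y) - Num.floor (s - y) ->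
  exists k : int, s < y + k%:~R <= t.
Proof.
rewrite subr_gt0 real_floor_lt_int ?num_real // => lt_s.
by exists (Num.floor (t - y)); have := floor_bounds (t - y); lra.
Qed.

(** Suppose that u and v, at distance h, have images at a distance d larger than
    h.  The arcs of radius a around g u and g v then cover a set of measure more
    than 2 * a + h.  A sample with its image there is at distance less than a
    from u or v, hence lies in an arc of length 2 * a + h.  For many samples this
    contradicts the density of preimages.

    The covered set is taken to be the whole arc around g u and a disjoint arc of
    length b inside the arc around g v; it begins p after the end of the
    arc around g u, where p > 0 only if the two arcs are disjoint. *)
Lemma spreading_no_stretch (R : archiRealFieldType) (a h d u v : R) (g : R -> R)
    (k : int) :
  0 < a < 2^-1 -> spreading a g -> 0 < h < 2 * a -> h < 1 - 2 * a ->
  `|u - v| = h -> h < d <= 2^-1 -> g v <> g u + d + k%:~R.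
Proof.
move=> a01 gP h2a h12a uvh hd gv.
pose b := Num.min (Num.min d (2 * a)) (1 - 2 * a).
have [hb bd b2a b12a] : [/\ h < b, b <= d, b <= 2 * a & b <= 1 - 2 * a].
  rewrite /b !lt_min !ge_min !lexx !orbT; split=> //.
  by apply/andP; split; last lra; apply/andP; split; lra.
pose p := Num.max 0 (d - 2 * a).
have [p0 pd pbd pb1] :
    [/\ 0 <= p, d - 2 * a <= p, p + b <= d & 2 * a + p + b <= 1].
  by rewrite /p; case: (lerP 0 (d - 2 * a)) => ?; split; lra.
clearbody b p.
pose e := (b - h) / 4.
have e0 : 0 < e by rewrite /e; lra.
have [|N1 dens1] := @arc_preimage_density R a (2 * a) e g a01 gP _ e0.
  by lra.
have [|N2 dens2] := @arc_preimage_density R a b e g a01 gP _ e0; first lra.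
pose N := (N1 + N2 + (Num.truncn (4 / (b - h))).+1)%N.
have N_gt : 4 < N%:R * (b - h).
  rewrite -ltr_pdivrMr; last lra.
  apply: lt_le_trans (_ : (Num.truncn (4 / (b - h))).+1%:R <= _).
    by apply: real_truncnS_gt; rewrite num_real.
  by rewrite ler_nat leq_addl.
have N_gt0 : 0 < N%:R :> R by rewrite ltr0n /N addnS.
have leN1 : (N1 <= N)%N by rewrite /N -addnA leq_addr.
have leN2 : (N2 <= N)%N by rewrite /N -addnA addnCA leq_addr.
clearbody N.
(* Starting the samples at m - a makes the arc of length 2 * a + h around u
   and v an initial segment of the samples. *)
pose m := Num.min u v.
have [mu mv um vm] : [/\ m <= u, m <= v, u <= m + h & v <= m + h].
  rewrite /m -uvh; case: (lerP u v) => uv; split; lra.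
clearbody m.
have {}dens1 := dens1 N (m - a) (g u - a) leN1.
have {}dens2 := dens2 N (m - a) (g u + a + p) leN2.
set y := @samples _ _ _ _ in dens1 dens2.
pose t i := (Num.floor (g u - a + 2 * a - y i) - Num.floor (g u - a - y i))
  + (Num.floor (g u + a + p + b - y i) - Num.floor (g u + a + p - y i)).
pose S := [set i : 'I_N | i%:R < N%:R * (2 * a + h)].
have near_S (i : 'I_N) (z : R) (j : int) :
    m <= z <= m + h -> `|m - a + i%:R / N%:R - z - j%:~R| < a -> i \in S.
  move=> mz; rewrite ltr_norml inE => near.
  have i0 : 0 <= i%:R / N%:R :> R by rewrite divr_ge0.
  have i1 : i%:R / N%:R < 1 :> R by rewrite ltr_pdivrMr // mul1r ltr_nat.
  rewrite mulrC -ltr_pdivrMr //.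
  case: (ltrgtP j 0) => [| |j0]; last by rewrite j0 in near; lra.
    by rewrite -lezD1 -(ler_int R) intrD; lra.
  by rewrite gtz0_ge1 -(ler_int R); lra.
have t_le1 i : t i <= 1.
  have lt2 :
      Num.floor (g u + a + p + b - y i) < Num.floor (g u - a - y i) + 1 + 1.
    rewrite real_floor_lt_int ?num_real // !intrD.
    by have := floor_bounds (g u - a - y i); lra.
  have le0 : Num.floor (g u - a + 2 * a - y i) <= Num.floor (g u + a + p - y i).
    by apply: le_floor; lra.
  by rewrite ltzD1 in lt2; rewrite /t; lra.
have t_gt0 i : 0 < t i -> i \in S.
  move=> ti.
  have [/floor_lt_arc[j jP]|/floor_lt_arc[j jP]] :
     0 < Num.floor (g u - a + 2 * a - y i) - Num.floor (g u - a - y i) \/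
     0 < Num.floor (g u + a + p + b - y i) - Num.floor (g u + a + p - y i).
    apply/orP; rewrite -[_ || _]negbK negb_or -!leNgt; apply/negP => /andP[].
    by move: ti; rewrite /t; lra.
  - have : `|y i - g u - (- j)%:~R| <= a by rewrite intrN ler_norml; lra.
    by move/(spreading_near gP) => [j']; apply: near_S; lra.
  - have : `|y i - g v - (- j - k)%:~R| <= a.
      by rewrite gv intrB intrN ler_norml; lra.
    by move/(spreading_near gP) => [j']; apply: near_S; lra.
have := sum_le_card t_le1 t_gt0.
rewrite /t big_split /= !sumrB -(ler_int R) intrD.
have := @card_initial_segment R N (N%:R * (2 * a + h)).
have -> : 0 <= N%:R * (2 * a + h) by rewrite mulr_ge0 //; lra.
move=> /(_ isT).
move: dens1 dens2; rewrite /lift_count -/S -[#|S|%:Z%:~R]/(#|S|%:R : R) /e; lra.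
Qed.

(** * No map is spreading *)

(** The triangle inequality, modulo 1. *)
Lemma contraction_iter (R : archiRealFieldType) (h : R) (g : R -> R) :
  (forall x, exists k : int, `|g (x + h) - g x - k%:~R| <= h) ->
  forall (n : nat) x,
    exists k : int, `|g (x + n%:R * h) - g x - k%:~R| <= n%:R * h.
Proof.
move=> gh; elim=> [|n IH] x.
  by exists 0; rewrite mul0r addr0 subrr subr0 normr0.
have [k1 k1P] := IH x; have [k2 k2P] := gh (x + n%:R * h).
exists (k1 + k2); rewrite intrD -natr1.
have -> : x + (n%:R + 1) * h = x + n%:R * h + h by ring.
set z := g _ in k2P *; set w := g _ in k1P k2P *.
have -> : z - g x - (k1%:~R + k2%:~R) = (w - g x - k1%:~R) + (z - w - k2%:~R).
  by ring.
by rewrite mulrDl mul1r; apply: le_trans (ler_normD _ _) _; apply: lerD k1P k2P.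
Qed.

(** Cut a into n steps short enough not to be stretched.  The images of 0 and a
    are then at distance at most a, although 0 and a are far. *)
Lemma not_spreading (R : archiRealFieldType) (a : R) (g : R -> R) :
  0 < a < 2^-1 -> ~ spreading a g.
Proof.
move=> a01 gP.
pose n := (Num.truncn (a / (1 - 2 * a))).+1.
have n_gt0 : 0 < n%:R :> R by rewrite ltr0n.
have n_ge1 : 1 <= n%:R :> R by rewrite ler1n.
have an : a < n%:R * (1 - 2 * a).
  rewrite -ltr_pdivrMr; last lra.
  by apply: real_truncnS_gt; rewrite num_real.
pose h := a / n%:R.
have nh : n%:R * h = a by rewrite /h mulrC divfK // gt_eqF.
have h_gt0 : 0 < h by rewrite divr_gt0 //; lra.
have h_le : h <= a by rewrite ler_pdivrMr // ler_peMr //; lra.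
have h_lt : h < 1 - 2 * a by rewrite ltr_pdivrMr // mulrC.
have h2a : 0 < h < 2 * a by lra.
clearbody h n.
have step x : exists k : int, `|g (x + h) - g x - k%:~R| <= h.
  pose k := Num.floor (g (x + h) - g x + 2^-1).
  have kP := floor_bounds (g (x + h) - g x + 2^-1); rewrite -/k in kP.
  exists k; rewrite leNgt; apply/negP.
  case: (ler0P (g (x + h) - g x - k%:~R)) => _ lt_h.
  - apply: (@spreading_no_stretch R a h (- (g (x + h) - g x - k%:~R))
              (x + h) x g (- k) a01 gP h2a h_lt).
    + by rewrite addrC addKr gtr0_norm.
    + by lra.
    + by rewrite intrN; ring.
  - apply: (@spreading_no_stretch R a h (g (x + h) - g x - k%:~R)
              x (x + h) g k a01 gP h2a h_lt).
    + by rewrite opprD addrA subrr sub0r normrN gtr0_norm.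
    + by lra.
    + by ring.
have [k] := contraction_iter step n 0; rewrite nh add0r leNgt => /negP; apply.
apply: gP => j; rewrite subr0.
case: (lerP j 0) => [|]; [|rewrite gtz0_ge1]; rewrite -(ler_int R) => jP.
  by rewrite ger0_norm; lra.
by rewrite ler0_norm; lra.
Qed.

(** * From the circle to the line *)

Lemma circle_point_subproof (R : realType) (x : R) :
  0 <= x - (Num.floor x)%:~R < 1.
Proof. by have := floor_bounds x; lra. Qed.

Definition circle_point (R : realType) (x : R) : circle R :=
  exist _ (x - (Num.floor x)%:~R) (circle_point_subproof x).

Lemma circle_dist_gt (R : realType) (a : R) (x y : circle R) :
  a < circle_dist x y -> strictly_far a (val x) (val y).
Proof.
case: x y => [x x01] [y y01].
rewrite /circle_dist lt_min /= => /andP[a1 a2] k.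
case: (ltrgtP k 0) => [| |->]; last by rewrite subr0.
  rewrite -lezD1 -(ler_int R) intrD => k0.
  by rewrite ger0_norm; [case: (ler0P (x - y)) a1 a2 => ?; lra|lra].
rewrite gtz0_ge1 -(ler_int R) => k0.
by rewrite ler0_norm; [case: (ler0P (x - y)) a1 a2 => ?; lra|lra].
Qed.

Lemma circle_dist_ge (R : realType) (a x y : R) :
  far a x y -> a <= circle_dist (circle_point x) (circle_point y).
Proof.
move=> xy; rewrite /circle_dist le_min /=.
have x01 := circle_point_subproof x; have y01 := circle_point_subproof y.
have := xy (Num.floor x - Num.floor y).
have := xy (Num.floor x - Num.floor y + 1).
have := xy (Num.floor x - Num.floor y - 1).
rewrite !(intrB, intrD).
set fx := (Num.floor x)%:~R in x01 *; set fy := (Num.floor y)%:~R in y01 *.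
have -> : x - y - (fx - fy) = x - fx - (y - fy) by ring.
have -> : x - y - (fx - fy + 1%:~R) = x - fx - (y - fy) - 1 by ring.
have -> : x - y - (fx - fy - 1%:~R) = x - fx - (y - fy) + 1 by ring.
move: (x - fx) (y - fy) x01 y01 => s t s01 t01 h1 h2 h0; apply/andP; split=> //.
have h3 : s - t - 1 <= 0 by lra.
have h4 : 0 <= s - t + 1 by lra.
move: h1 h2; rewrite (ler0_norm h3) (ger0_norm h4).
by case: (ler0P (s - t)) => ?; lra.
Qed.

(** Distinct non-adjacent points are at distance at least 1 / r in the open
    graph and more than 1 / r in the closed one; hence a cohomomorphism from the
    former to the latter, read in real coordinates, is spreading. *)
Lemma cohomomorphism_spreading (R : realType) (r : R)
    (f : open_circle_graph r -> closed_circle_graph r) :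
  0 < r -> cohomomorphism f ->
  spreading r^-1 (fun x => val (f (circle_point x) : circle R)).
Proof.
move=> r_gt0 fP x y xy; apply: circle_dist_gt.
have le_dist := circle_dist_ge xy.
have rV_gt0 : 0 < r^-1 by rewrite invr_gt0.
have neq : circle_point x <> circle_point y.
  move=> eqxy; move: le_dist; rewrite eqxy /circle_dist subrr normr0 subr0.
  by rewrite min_l // leNgt rV_gt0.
have [fneq nadj] : f (circle_point x) <> f (circle_point y) /\
    ~ closed_adj r (f (circle_point x)) (f (circle_point y)).
  by apply: fP => // -[_]; rewrite ltNge le_dist.
by rewrite ltNge; apply/negP => le_r; apply: nadj.
Qed.

Theorem theorem1p5 (R : realType) (r : R) (hr : 2 < r) :
  ~ graph_equiv (closed_circle_graph r) (open_circle_graph r).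
Proof.
move=> [_ [f /cohomomorphism_spreading fP]].
have r_gt0 : 0 < r by lra.
apply: (not_spreading _ (fP r_gt0)).
by rewrite invr_gt0 r_gt0 ltf_pV2 // posrE.
Qed.
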